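(* Let $\mathbf{X}=(X_1,\ldots,X_N)$ be real-valued random variables with joint probability density $p$ on $\mathbb{R}^N$ (with respect to Lebesgue measure), marginal densities $p_1,\ldots,p_N$, marginal distribution functions $F_1,\ldots,F_N$, and copula density $c$ on $[0,1]^N$. Then the mutual information of $\mathbf{X}$ equals the negative of its copula entropy: $$I(\mathbf{x}) = -H_c(\mathbf{x}),$$ that is, $$\int_{\mathbb{R}^N} p(\mathbf{x})\log\frac{p(\mathbf{x})}{\prod_{i=1}^N p_i(x_i)}\,d\mathbf{x} = \int_{[0,1]^N} c(\mathbf{u})\log c(\mathbf{u})\,d\mathbf{u}.$$
   Context: Copula: the joint distribution function $D$ of $\mathbf{X}=(X_1,\ldots,X_N)$ can be written (Sklar) as $D(\mathbf{x})=C(F_1(x_1),\ldots,F_N(x_N))$, where $F_i$ is the marginal distribution function of $X_i$ and $C$, the copula of $\mathbf{X}$, is a distribution function on $[0,1]^N$ with uniform margins. The copula density $c$ is the density of $C$ with respect to Lebesgue measure on $[0,1]^N$; write $\mathbf{u}=(u_1,\ldots,u_N)$ with $u_i=F_i(x_i)$. Copula entropy: $H_c(\mathbf{x}) = -\int_{[0,1]^N} c(\mathbf{u})\log c(\mathbf{u})\,d\mathbf{u}$. Mutual information: $I(\mathbf{x})=\int_{\mathbb{R}^N} p(\mathbf{x})\log\frac{p(\mathbf{x})}{\prod_{i=1}^N p_i(x_i)}\,d\mathbf{x}$. Conventions: $0\log 0=0$, and the integrand in $I$ is $0$ where $p(\mathbf{x})=0$. The values $I(\mathbf{x})=+\infty$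 and $H_c(\mathbf{x})=-\infty$ are allowed. *)

(* Defs.v *)
From HB Require Import structures.
From mathcomp Require Import all_boot all_order all_algebra.
From mathcomp Require Import all_classical all_reals all_analysis.
Set Implicit Arguments.
Unset Strict Implicit.
Unset Printing Implicit Defensive.
Import Order.TTheory GRing.Theory Num.Theory.
Import numFieldNormedType.Exports.
Local Open Scope classical_set_scope.
Local Open Scope ring_scope.
Local Open Scope ereal_scope.

Definition cons_pair (T : Type) (n : nat) (x : T * n.-tuple T) : n.+1.-tuple T :=
  [tuple of x.1 :: x.2].

Lemma measurable_cons_pair d (T : measurableType d) (n : nat) :
  measurable_fun [set: T * n.-tuple T] (@cons_pair T n).
Proof. exact: measurable_cons. Qed.

Section cons_measure.
Context {d : measure_display} {T : measurableType d} {R : realType} {n : nat}.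
Variable m1 : {sigma_finite_measure set T -> \bar R}.
Variable m2 : {sigma_finite_measure set (n.-tuple T) -> \bar R}.

Definition cons_measure : set (n.+1.-tuple T) -> \bar R :=
  pushforward (m1 \x m2) (@cons_pair T n).

HB.instance Definition _ := Measure.copy cons_measure
  (measure_function_pushforward__canonical__measure_function_Measure
    (m1 \x m2) (@measurable_cons_pair d T n)).

Let cons_measure_sigma_finite : sigma_finite setT cons_measure.
Proof.
have /sigma_finiteP[F [FT ndF Foo]] := sigma_finiteT m1.
have /sigma_finiteP[G [GT ndG Goo]] := sigma_finiteT m2.
pose g (t : n.+1.-tuple T) : T * n.-tuple T := (thead t, [tuple of behead t]).
have gK : cancel g (@cons_pair T n) by move=> t; rewrite [RHS]tuple_eta.
have Kg : cancel (@cons_pair T n) g.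
  move=> [x t]; rewrite /g /cons_pair /=; congr pair.
  by apply/val_inj.
have mg : measurable_fun setT g.
  apply/measurable_fun_pairP; split; first exact: measurable_tnth.
  exact: measurable_behead.
exists (fun k => g @^-1` (F k `*` G k)).
  apply/esym; rewrite -subTset => t _.
  have [i _ Fi] : (\bigcup_i F i) (g t).1 by rewrite -FT.
  have [j _ Gj] : (\bigcup_i G i) (g t).2 by rewrite -GT.
  exists (maxn i j) => //; split.
    by move: Fi; exact/subsetPset/ndF/leq_maxl.
  by move: Gj; exact/subsetPset/ndG/leq_maxr.
move=> k; have [mFk Fkoo] := Foo k; have [mGk Gkoo] := Goo k.
have mFG : measurable (F k `*` G k) by exact: measurableX.
split; first by rewrite -[X in measurable X]setTI; exact: mg.
rewrite /cons_measure /pushforward -comp_preimage.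
rewrite (_ : g \o _ = id) ?preimage_id.
  by rewrite product_measure1E// lte_mul_pinfty// ge0_fin_numE.
by apply/funext => x; exact: Kg.
Qed.

HB.instance Definition _ := @Measure_isSigmaFinite.Build _ _ _
  cons_measure cons_measure_sigma_finite.

End cons_measure.

(* [lebesgue_measure] is declared on [measurableTypeR R]; this is the same measure
   on the canonical measurable structure of R, which has the same measurable sets
   but a different display. *)
Section lebesgue_real.
Context {R : realType}.

Definition lebesgue_real : set R -> \bar R := @lebesgue_measure R.

Let lebesgue_real0 : lebesgue_real set0 = 0.
Proof. exact: measure0. Qed.

Let lebesgue_real_ge0 A : 0 <= lebesgue_real A.
Proof. exact: (measure_ge0 (@lebesgue_measure R)). Qed.

Let lebesgue_real_sigma_additive : semi_sigma_additive lebesgue_real.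
Proof. exact: (@measure_semi_sigma_additive _ _ _ (@lebesgue_measure R)). Qed.

HB.instance Definition _ := isMeasure.Build _ _ _ lebesgue_real
  lebesgue_real0 lebesgue_real_ge0 lebesgue_real_sigma_additive.

Let lebesgue_real_sigma_finite : sigma_finite setT lebesgue_real.
Proof. exact: (sigma_finiteT (@lebesgue_measure R)). Qed.

HB.instance Definition _ := @Measure_isSigmaFinite.Build _ _ _
  lebesgue_real lebesgue_real_sigma_finite.

End lebesgue_real.

(* Lebesgue measure on R^N, as the N-fold product of [lebesgue_measure]; the
   sigma-algebra on [N.-tuple R] is the product (Borel) one. *)
Fixpoint lebesgue_tuple (R : realType) (N : nat) :
    {sigma_finite_measure set (N.-tuple R) -> \bar R} :=
  match N with
  | 0 => \d_([tuple])
  | N'.+1 => cons_measure (@lebesgue_real R) (lebesgue_tuple R N')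
  end.

Lemma lebesgue_tuple_box (R : realType) (N : nat) (A : 'I_N -> set R) :
  (forall i, measurable (A i)) ->
  lebesgue_tuple R N [set x | forall i, A i (tnth x i)] =
    \prod_(i < N) lebesgue_measure (A i).
Proof.
elim: N A => [|N IH] A mA.
  rewrite big_ord0 /= diracE (_ : _ \in _ = true)//.
  by apply/mem_set => -[].
rewrite big_ord_recl -IH//= /cons_measure /pushforward.
have mB : measurable [set x : N.-tuple R | forall i, A (lift ord0 i) (tnth x i)].
  rewrite (_ : mkset _ =
      \bigcap_(i in [set: 'I_N]) ((@tnth N R)^~ i @^-1` A (lift ord0 i))).
    apply: fin_bigcap_measurable => // i _.
    by rewrite -[X in measurable X]setTI; exact: measurable_tnth.
  by apply/seteqP; split => x /= h i; [move=> _; exact: h|exact: h].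
rewrite -[lebesgue_measure _]/(lebesgue_real _) -product_measure1E//.
congr ((_ \x _) _); apply/seteqP; split => -[x t] /=.
  move=> h; split; first exact: (h ord0).
  by move=> i; have := h (lift ord0 i); rewrite tnthS.
move=> [h0 h] i; case: (unliftP ord0 i) => [j ->|->//].
by rewrite tnthS; exact: h.
Qed.

Section random_vector.
Context {d : measure_display} {T : measurableType d} {R : realType}
  {P : probability T R} {N : nat}.
Variable X : 'I_N -> {RV P >-> R}.

Definition random_vector (w : T) : N.-tuple R := [tuple X i w | i < N].

Let measurable_random_vector : measurable_fun setT random_vector.
Proof.
apply/measurable_fun_tnthP => i; rewrite (_ : _ \o _ = X i)//.
by apply/funext => w; rewrite /= tnth_mktuple.
Qed.

HB.instance Definition _ := isMeasurableFun.Build _ _ _ _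
  random_vector measurable_random_vector.

End random_vector.

Section distribution_functions.
Context {R : realType} {N : nat}.

Definition distribution_function (mu : set (N.-tuple R) -> \bar R)
    (x : N.-tuple R) : \bar R :=
  mu [set y | forall i, (tnth y i <= tnth x i)%R].

Definition is_density d (T : measurableType d) (mu nu : set T -> \bar R)
    (f : T -> R) : Prop :=
  [/\ measurable_fun setT f, forall x, (0 <= f x)%R &
      forall A, measurable A -> nu A = \int[mu]_(x in A) (f x)%:E].

Definition unit_cube : set (N.-tuple R) :=
  [set u | forall i, (0 <= tnth u i <= 1)%R].

(* A copula: the restriction to the unit cube of the distribution function of a
   probability measure carried by the cube, with uniform margins; the i-th
   margin at t is the value of C at the point with i-th coordinate t and all
   other coordinates 1. *)
Definition is_copula (C : N.-tuple R -> \bar R) : Prop :=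
  (exists Q : probability (N.-tuple R) R, Q unit_cube = 1 /\
     forall u, unit_cube u -> C u = distribution_function Q u) /\
  (forall (i : 'I_N) (t : R), (0 <= t <= 1)%R ->
     C [tuple if j == i then t else 1%R | j < N] = t%:E).

Definition is_copula_density (C : N.-tuple R -> \bar R) (c : N.-tuple R -> R) :
    Prop :=
  [/\ measurable_fun unit_cube c, forall u, unit_cube u -> (0 <= c u)%R &
      forall u, unit_cube u ->
        C u = \int[lebesgue_tuple R N]_(v in
          [set v | forall i, (0 <= tnth v i <= tnth u i)%R]) (c v)%:E].

(* The products below use the conventions of the extended reals: 0 * -oo = 0 and
   [lne 0 = -oo], so 0 log 0 = 0; and 0 * +oo = 0 with 1 / 0 = +oo, so the
   integrand of the mutual information is 0 wherever p vanishes. *)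
Definition copula_entropy (c : N.-tuple R -> R) : \bar R :=
  - \int[lebesgue_tuple R N]_(u in unit_cube) ((c u)%:E * lne (c u)%:E).

Definition mutual_information (p : N.-tuple R -> R) (pm : 'I_N -> R -> R) :
    \bar R :=
  \int[lebesgue_tuple R N]_x
    ((p x)%:E * lne ((p x)%:E / (\prod_(i < N) pm i (tnth x i))%R%:E)).

End distribution_functions.

(* Sklar's decomposition D(x) = C(F_1(x_1), ..., F_N(x_N)). *)
Definition copula_of d (T : measurableType d) (R : realType)
    (P : probability T R) (N : nat) (X : 'I_N -> {RV P >-> R})
    (C : N.-tuple R -> \bar R) : Prop :=
  is_copula C /\
  forall x : N.-tuple R,
    distribution_function (distribution P (random_vector X)) x =
    C [tuple fine (cdf (X i) (tnth x i)) | i < N].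

(* Main.v *)
(** Let [w] be the product of the marginal densities, [nu] the measure with
    density [w], and F(x) = (F_1(x_1), ..., F_N(x_N)). By the probability
    integral transform, F pushes [nu] forward to Lebesgue measure on the unit
    cube. Hence C(F(x)), the integral of [c] over the box [0, F(x)], is the
    integral of (c o F) w over the preimage of that box, which differs from the
    orthant {y <= x} by a [nu]-null set. By Sklar's identity, p and (c o F) w
    thus have the same integral over every orthant, so p = (c o F) w almost
    everywhere. The mutual information is therefore the [nu]-integral of
    (c log c) o F, and transporting it along F gives the integral of c log c
    over the cube. *)

Require Import Defs.
From HB Require Import structures.
From mathcomp Require Import all_boot all_order all_algebra.
From mathcomp Require Import all_classical all_reals all_analysis.
From mathcomp Require Import measurable_realfun.
Set Implicit Arguments.
Unset Strict Implicit.
Unset Printing Implicit Defensive.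
Import Order.TTheory GRing.Theory Num.Theory.
Import numFieldNormedType.Exports.
Local Open Scope classical_set_scope.
Local Open Scope ring_scope.
Local Open Scope ereal_scope.

(** * Measures given by a density *)

Section density_measure.
Context {d : measure_display} {T : measurableType d} {R : realType}.
Variables (mu : {measure set T -> \bar R}) (f : T -> R).

(** The proofs [mf] and [f0] are carried as arguments so that the measure structure can be recovered
    from the term alone. *)
Definition density_measure (mf : measurable_fun [set: T] f)
    (f0 : forall x, (0 <= f x)%R) (A : set T) : \bar R :=
  \int[mu]_(x in A) (f x)%:E.

Hypothesis mf : measurable_fun [set: T] f.
Hypothesis f0 : forall x, (0 <= f x)%R.

Let density_measure0 : density_measure mf f0 set0 = 0.
Proof. by rewrite /density_measure integral_set0. Qed.

Let density_measure_ge0 A : 0 <= density_measure mf f0 A.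
Proof. by apply: integral_ge0 => x _; rewrite lee_fin. Qed.

Let density_measure_sigma_additive :
  semi_sigma_additive (density_measure mf f0).
Proof.
move=> A mA tA mUA; rewrite /density_measure ge0_integral_bigcup//; last 2 first.
- by apply/measurable_EFinP; exact: measurable_funTS.
- by move=> x _; rewrite lee_fin.
apply: is_cvg_ereal_nneg_natsum_cond => n _ _.
by apply: integral_ge0 => /= x _; rewrite lee_fin.
Qed.

HB.instance Definition _ := isMeasure.Build _ _ _ (density_measure mf f0)
  density_measure0 density_measure_ge0 density_measure_sigma_additive.

End density_measure.

(** Both [w] and the Radon-Nikodym derivative of [nu] integrate to [nu] on every measurable set, so
    they agree almost everywhere, and the change of variables for the derivative carries over to
    [w]. *)
Lemma integral_density d (T : measurableType d) (R : realType)
    (mu : {sigma_finite_measure set T -> \bar R})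
    (nu : {finite_measure set T -> \bar R}) (w : T -> R)
    (E : set T) (h : T -> \bar R) :
  is_density mu nu w -> measurable E -> measurable_fun E h ->
  (forall x, 0 <= h x) ->
  \int[nu]_(x in E) h x = \int[mu]_(x in E) (h x * (w x)%:E).
Proof.
move=> [mw w0 nuE] mE mh h0.
have numu : nu `<< mu.
  apply/null_content_dominatesP => A mA muA.
  rewrite nuE// null_set_integral//.
  by apply/measurable_EFinP; exact: measurable_funTS.
have wRN : ae_eq mu setT (Radon_Nikodym_SigmaFinite.f nu mu) (EFin \o w).
  apply: integral_ae_eq => //.
  - exact: Radon_Nikodym_SigmaFinite.f_integrable.
  - exact/measurable_EFinP.
  - by move=> A _ mA; rewrite -Radon_Nikodym_SigmaFinite.f_integral//= nuE.
rewrite -(Radon_Nikodym_SigmaFinite.change_of_variables numu)//.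
apply: ge0_ae_eq_integral => //.
- apply: emeasurable_funM => //; apply: measurable_funTS.
  exact/measurable_int/Radon_Nikodym_SigmaFinite.f_integrable.
- apply: emeasurable_funM => //.
  by apply/measurable_EFinP; exact: measurable_funTS.
- by move=> x _; rewrite mule_ge0//; exact: Radon_Nikodym_SigmaFinite.f_ge0.
- by move=> x _; rewrite mule_ge0// lee_fin.
- by apply: ae_eqe_mul2l; exact: ae_eq_subset wRN.
Qed.

(** * Boxes, orthants and product integrals on the tuple space *)

Section tuple_measure.
Context {R : realType} {N : nat}.
Implicit Types (A : 'I_N -> set R) (m : {measure set (N.-tuple R) -> \bar R}).

Definition box A : set (N.-tuple R) := [set x | forall i, A i (tnth x i)].

Definition lower_orthant (x : N.-tuple R) : set (N.-tuple R) :=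
  [set y | forall i, (tnth y i <= tnth x i)%R].

Lemma lower_orthantE x : lower_orthant x = box (fun i => `]-oo, tnth x i]%classic).
Proof. by apply/seteqP; split => y h i; have := h i; rewrite /= in_itv. Qed.

Lemma measurable_box A : (forall i, measurable (A i)) -> measurable (box A).
Proof.
move=> mA.
rewrite (_ : box A = \bigcap_(i in [set: 'I_N]) ((@tnth N R)^~ i @^-1` A i)).
  apply: fin_bigcap_measurable => // i _.
  by rewrite -[X in measurable X]setTI; exact: measurable_tnth.
by apply/seteqP; split => x /= h i; [move=> _; exact: h|exact: h].
Qed.

Lemma measurable_lower_orthant x : measurable (lower_orthant x).
Proof. by rewrite lower_orthantE; apply: measurable_box => i. Qed.

Lemma lower_orthant_cover :
  \bigcup_n lower_orthant [tuple n%:R | _ < N] = [set: N.-tuple R].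
Proof.
(* The witness is an integer exceeding every coordinate of [y]. *)
rewrite -subTset => y _; exists (\max_(i < N) (Num.truncn (tnth y i)).+1)%N => // i.
rewrite tnth_mktuple; apply: le_trans (ltW (truncnS_gt _)) _.
by rewrite ler_nat; exact: (@leq_bigmax _ (fun i => (Num.truncn (tnth y i)).+1)).
Qed.

Lemma tuple_measurableE :
  @measurable _ (N.-tuple R) = <<s range lower_orthant >>.
Proof.
apply/seteqP; split; last first.
  apply: smallest_sub; first exact: sigma_algebra_measurable.
  by move=> _ [x _ <-]; exact: measurable_lower_orthant.
apply: smallest_sub; first exact: smallest_sigma_algebra.
(* A half-space is the union of orthants whose bound is [r] in coordinate [i] and [n] elsewhere, as
   [n] grows. *)
have ray i (r : R) : <<s range lower_orthant >> [set y | (tnth y i <= r)%R].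
  rewrite (_ : mkset _ = \bigcup_n lower_orthant
      [tuple if j == i then r else n%:R | j < N]).
    apply: sigma_algebra_bigcup => n; apply: sub_sigma_algebra.
    by eexists.
  apply/seteqP; split => y /=.
    move=> yr; have [n _ yn] : (\bigcup_n lower_orthant [tuple n%:R | _ < N]) y.
      by rewrite lower_orthant_cover.
    exists n => // j; rewrite tnth_mktuple; case: eqP => [->//|_].
    by have := yn j; rewrite tnth_mktuple.
  by move=> [n _ /(_ i)]; rewrite tnth_mktuple eqxx.
apply: (big_ind (fun S => S `<=` <<s range lower_orthant >>)) => //.
  by move=> S1 S2 h1 h2 S [/h1|/h2].
move=> i _ _ [B mB <-]; rewrite setTI.
(* The sets on the right form a sigma-algebra, so only the generating rays ]r, +oo[ remain; their
   preimages are complements of half-spaces. *)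
suff: @measurable _ R `<=`
    [set B | <<s range lower_orthant >> ((@tnth N R)^~ i @^-1` B)] by exact.
have -> : @measurable _ R = (@RGenOInfty.G R).-sigma.-measurable.
  exact: RGenOInfty.measurableE.
apply: smallest_sub.
  split => /=.
  - by rewrite preimage_set0; exact: sigma_algebra0.
  - by move=> C hC; rewrite setTD preimage_setC; exact: sigma_algebraC.
  - by move=> C hC; rewrite preimage_bigcup; exact: sigma_algebra_bigcup.
move=> _ [r ->] /=.
rewrite (_ : _ @^-1` _ = ~` [set y | (tnth y i <= r)%R]).
  exact: sigma_algebraC.
by apply/seteqP; split => y /=; rewrite in_itv/= andbT ltNge => /negP.
Qed.

(** Orthants generate the sigma-algebra, are stable under intersection (coordinatewise minimum of
    the corners), and countably many of finite measure cover the space. *)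
Lemma tuple_measure_unique m1 m2 :
  (forall x, m1 (lower_orthant x) = m2 (lower_orthant x)) ->
  (forall x, m1 (lower_orthant x) < +oo) ->
  forall S, measurable S -> m1 S = m2 S.
Proof.
move=> m12 m1oo S mS.
apply: (measure_unique (range lower_orthant)
  (fun n => lower_orthant [tuple n%:R | _ < N])) => //.
- exact: tuple_measurableE.
- move=> _ _ [x _ <-] [y _ <-].
  exists [tuple Num.min (tnth x i) (tnth y i) | i < N] => //.
  apply/seteqP; split => z.
    by move=> h; split => i; have := h i; rewrite tnth_mktuple le_min => /andP[].
  by move=> [h1 h2] i; rewrite tnth_mktuple le_min h1 h2.
- exact: lower_orthant_cover.
- by move=> _ [x _ <-].
Qed.

End tuple_measure.

(** Induction on [N]: the measure in dimension [N.+1] is a pushforward of a product, so Tonelli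
    splits off the first coordinate. In dimension 0 a Dirac mass integrates the empty product to
    1. *)
Lemma integral_prod_tuple (R : realType) (N : nat) (f : 'I_N -> R -> R) :
  (forall i, measurable_fun setT (f i)) -> (forall i x, (0 <= f i x)%R) ->
  \int[lebesgue_tuple R N]_x (\prod_(i < N) f i (tnth x i))%:E =
  \prod_(i < N) \int[lebesgue_real]_x (f i x)%:E.
Proof.
have mP n (g : 'I_n -> R -> R) : (forall i, measurable_fun setT (g i)) ->
    measurable_fun setT (fun x : n.-tuple R => (\prod_(i < n) g i (tnth x i))%:E).
  move=> mg; apply/measurable_EFinP; apply: measurable_prod => i _.
  by apply: measurableT_comp (mg i) _; exact: measurable_tnth.
have P0 n (g : 'I_n -> R -> R) : (forall i x, (0 <= g i x)%R) ->
    forall x : n.-tuple R, 0 <= (\prod_(i < n) g i (tnth x i))%:E.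
  by move=> g0 x; rewrite lee_fin prodr_ge0.
elim: N f => [|N IH] f mf f0.
  by rewrite /= integral_dirac ?big_ord0//= ?diracT ?big_ord0 ?mul1e//; exact: mP.
have mPf := mP _ _ mf.
have := @ge0_integral_pushforward _ _ _ _ _ (@cons_pair R N)
  (@measurable_cons_pair _ _ _) (lebesgue_real \x lebesgue_tuple R N)
  setT _ measurableT mPf (fun x _ => P0 _ _ f0 x).
rewrite preimage_setT => ->.
rewrite fubini_tonelli1//; last 2 first.
- apply: measurableT_comp => //; exact: measurable_cons_pair.
- by move=> x; exact: P0.
rewrite /fubini_F/= big_ord_recl -(IH (fun i => f (lift ord0 i)))//.
rewrite -ge0_integralZr//.
- apply: eq_integral => x _ /=; rewrite -ge0_integralZl//.
  + apply: eq_integral => y _ /=; rewrite -EFinM big_ord_recl; congr (_ * _)%:E.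
    by apply: eq_bigr => i _; rewrite tnthS.
  + exact: (mP _ (fun i => f (lift ord0 i))).
  + by move=> y _; exact: (P0 _ (fun i => f (lift ord0 i))).
  + by rewrite lee_fin.
- exact/measurable_EFinP.
- by move=> x _; rewrite lee_fin.
- by apply: integral_ge0 => y _; exact: (P0 _ (fun i => f (lift ord0 i))).
Qed.

(** * The probability integral transform on the real line *)

Section probability_integral_transform.
Context {d : measure_display} {T : measurableType d} {R : realType}
  {P : probability T R} (X : {RV P >-> R}).

Definition cdfR (x : R) : R := fine (cdf X x).

Lemma cdfRE x : cdf X x = (cdfR x)%:E.
Proof. by rewrite /cdfR fineK// fin_num_measure. Qed.

Lemma cdfR_ge0 x : (0 <= cdfR x)%R.
Proof. by rewrite -lee_fin -cdfRE cdf_ge0. Qed.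

Lemma cdfR_le1 x : (cdfR x <= 1)%R.
Proof. by rewrite -lee_fin -cdfRE cdf_le1. Qed.

Lemma cdfR_homo : {homo cdfR : x y / (x <= y)%R}.
Proof. by move=> x y xy; rewrite -lee_fin -!cdfRE cdf_nondecreasing. Qed.

Lemma measurable_cdfR : measurable_fun [set: R] cdfR.
Proof. exact: nondecreasing_measurable cdfR_homo. Qed.

(** The point is the supremum of the sublevel set. Beyond it the distribution function exceeds [t],
    and right-continuity brings the bound back to the point itself. Whether the supremum belongs to
    the set is left open. *)
Lemma sublevel_cdfR (t : R) : (0 <= t < 1)%R ->
  [set y | (cdfR y <= t)%R] !=set0 ->
  exists2 x, [set y | (cdfR y <= t)%R] `<=` `]-oo, x] /\
    `]-oo, x[ `<=` [set y | (cdfR y <= t)%R] & (t <= cdfR x)%R.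
Proof.
move=> /andP[t0 t1] [s0 Fs0]; set S := mkset _.
(* The limit 1 at +oo exceeds [t], so some [b] has value above [t] and bounds the sublevel set by
   monotonicity. *)
have [b tFb] : exists b, (t < cdfR b)%R.
  have [M [_ Mt]] := cvgr_gt _ (fine_cvg (cvg_cdfy1 X)) _ t1.
  by exists (M + 1)%R; apply: Mt; rewrite ltrDl.
have ubS : has_ubound S.
  exists b => y Sy; rewrite leNgt; apply/negP => /ltW /cdfR_homo.
  by move=> /(lt_le_trans tFb); rewrite ltNge Sy.
exists (sup S); first split.
- by move=> y Sy; rewrite /= in_itv/=; exact: ub_le_sup.
- move=> y; rewrite /= in_itv/= => yx.
  have [s Ss ys] : exists2 s, S s & (y < s)%R by apply/sup_gt => //; exists s0.
  exact: le_trans (cdfR_homo (ltW ys)) Ss.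
- rewrite -lee_fin -cdfRE.
  apply: (cvge_ge _ (@cdf_right_continuous _ _ _ _ X (sup S))).
  near=> y; rewrite cdfRE lee_fin leNgt; apply/negP => /ltW Sy.
  have : (sup S < y)%R by near: y; exact: nbhs_right_gt.
  by rewrite ltNge ub_le_sup.
Unshelve. all: by end_near. Qed.

Hypothesis no_atom : forall r, distribution P X [set r] = 0.

(** Outside [0, 1) both sides are trivial. Inside, the sublevel set is a ray up to its endpoint,
    which is no atom, and the distribution function equals [t] at that endpoint even where it has
    flat pieces. *)
Lemma probability_integral_transform (t : R) :
  distribution P X [set y | (cdfR y <= t)%R] =
  lebesgue_real ([set y | (0 <= y <= 1)%R] `&` `]-oo, t]).
Proof.
have [t0|t0] := ltP t 0%R.
  rewrite (_ : mkset _ = set0); last first.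
    by rewrite -subset0 => y /= /le_lt_trans/(_ t0); rewrite ltNge cdfR_ge0.
  rewrite (_ : _ `&` _ = set0) ?measure0// -subset0 => y /=.
  rewrite in_itv/= => -[/andP[y0 _] /(le_trans y0)].
  by rewrite leNgt t0.
have [t1|t1] := leP 1%R t.
  rewrite (_ : mkset _ = setT) ?probability_setT; last first.
    by rewrite -subTset => y _ /=; exact: le_trans (cdfR_le1 _) t1.
  rewrite (_ : _ `&` _ = `[0%R, 1%R]%classic).
    by rewrite [RHS]lebesgue_measure_itv/= lte_fin ltr01 sube0.
  apply/seteqP; split => y /=; rewrite !in_itv/=; first by case.
  by move=> /[dup] y01 /andP[_ y1]; split => //; exact: le_trans t1.
rewrite (_ : _ `&` _ = `[0%R, t]%classic); last first.
  apply/seteqP; split => y /=; rewrite !in_itv/=.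
    by move=> [/andP[-> _] ->].
  by move=> /andP[-> yt]; rewrite yt (le_trans yt (ltW t1)).
rewrite [RHS]lebesgue_measure_itv/= lte_fin.
have -> : (if (0 < t)%R then t%:E - 0 else 0) = t%:E.
  by case: ltP => [_|t0']; rewrite ?sube0//; congr EFin; apply/le_anti/andP.
(* An empty sublevel set forces [t] to be 0, because the distribution function tends to 0 at -oo. *)
have [S0|/set0P S0] := eqVneq [set y | (cdfR y <= t)%R] set0.
  rewrite S0 measure0; congr EFin; apply/le_anti; rewrite t0 leNgt.
  apply/negP => t_gt0.
  have [M [_ Mt]] := cvgr_lt _ (fine_cvg (cvg_cdfNy0 X)) _ t_gt0.
  suff : (set0 : set R) (M - 1)%R by [].
  by rewrite -S0; apply/ltW/Mt; rewrite ltrBlDr ltrDl.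
have t01 : (0 <= t < 1)%R by rewrite t0.
have [x [Sx xS] tFx] := sublevel_cdfR t01 S0.
have mS : measurable [set y | (cdfR y <= t)%R].
  rewrite (_ : mkset _ = cdfR @^-1` `]-oo, t]).
    by rewrite -[X in measurable X]setTI; exact: measurable_cdfR.
  by apply/seteqP; split => y /=; rewrite in_itv.
(* Without atoms the open and closed rays at [x] have the same mass, so the sublevel set, lying
   between them, has it too. *)
have mx : distribution P X `]-oo, x[ = cdf X x.
  rewrite /cdf -(@setUitv1 _ _ -oo%O x true)// measureU//= ?no_atom ?adde0//.
  by rewrite -subset0 => y /= []; rewrite in_itv/= => /[swap] ->; rewrite ltxx.
have cdfx : cdf X x = distribution P X [set y | (cdfR y <= t)%R].
  apply/le_anti/andP; split; last by rewrite le_measure ?inE.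
  by rewrite -mx le_measure ?inE.
rewrite -cdfx; apply/le_anti/andP; split; last by rewrite cdfRE lee_fin.
rewrite -mx.
(* Only the bound by [t] from above remains. The rays [E n] increase to the open ray at [x], and
   each has mass at most [t] since its endpoint lies in the sublevel set. *)
pose E n := `]-oo, (x - n.+1%:R^-1)%R]%classic.
have EU : \bigcup_n E n = `]-oo, x[%classic.
  apply/seteqP; split => y.
    move=> [n _]; rewrite /E /= !in_itv/= => /le_lt_trans; apply.
    by rewrite ltrBlDr ltrDl invr_gt0.
  rewrite /= in_itv/= => yx; have [n yn] := ltr_add_invr yx.
  by exists n => //; rewrite /E /= in_itv/= lerBrDr ltW.
have : distribution P X \o E @ \oo --> distribution P X (\bigcup_n E n).
  apply: nondecreasing_cvg_mu => //.
  - by move=> n; exact: measurable_itv.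
  - by rewrite EU; exact: measurable_itv.
  - move=> m n mn; apply/subsetPset => y; rewrite /E /= !in_itv/= => /le_trans.
    by apply; rewrite lerD2l lerN2 lef_pV2 ?posrE// ler_nat.
rewrite EU; apply: cvge_le; apply: nearW => n /=.
rewrite -[distribution P X _]/(cdf X (x - n.+1%:R^-1)%R) cdfRE lee_fin.
by apply: xS; rewrite /= in_itv/= ltrBlDr ltrDl invr_gt0.
Qed.

End probability_integral_transform.

Lemma integral_prod_box (R : realType) (N : nat) (f : 'I_N -> R -> R)
    (A : 'I_N -> set R) :
  (forall i, measurable_fun setT (f i)) -> (forall i x, (0 <= f i x)%R) ->
  (forall i, measurable (A i)) ->
  \int[lebesgue_tuple R N]_(x in box A) (\prod_(i < N) f i (tnth x i))%:E =
  \prod_(i < N) \int[lebesgue_real]_(x in A i) (f i x)%:E.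
Proof.
move=> mf f0 mA.
(* The indicator of a box is the product of the indicators of its sides, so each one is absorbed
   into its factor. *)
pose g i x := (f i x * \1_(A i) x)%R.
transitivity (\prod_(i < N) \int[lebesgue_real]_x (g i x)%:E).
  rewrite -integral_prod_tuple; last 2 first.
  - by move=> i; apply: measurable_funM => //; exact: measurable_indic.
  - by move=> i x; rewrite mulr_ge0.
  rewrite integral_mkcond; apply: eq_integral => x _.
  rewrite patchE big_split/=; case: ifPn => [|xA].
    rewrite inE => xA; rewrite [X in (_ * X)%R]big1 ?mulr1// => i _.
    by rewrite indicE mem_set//; exact: xA.
  have [i xAi] : exists i, ~ A i (tnth x i).
    by apply/existsNP => h; move/negP: xA; apply; rewrite inE.
  rewrite (bigD1 i)//= [X in (_ * X)%R](bigD1 i)//=.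
  by rewrite indicE memNset// mul0r mulr0.
apply: eq_bigr => i _; rewrite [RHS]integral_mkcond; apply: eq_integral => x _.
by rewrite /g EFinM epatch_indic.
Qed.

(** * The product of the marginal laws and its image under the marginal transform *)

Section marginals.
Context {d : measure_display} {T : measurableType d} {R : realType}
  {P : probability T R} {N : nat}.
Variables (X : 'I_N -> {RV P >-> R}) (pm : 'I_N -> R -> R).

Definition marginal_product (x : N.-tuple R) : R :=
  (\prod_(i < N) pm i (tnth x i))%R.

Definition marginal_transform (x : N.-tuple R) : N.-tuple R :=
  [tuple cdfR (X i) (tnth x i) | i < N].

Local Notation w := marginal_product.
Local Notation F := marginal_transform.
Local Notation L := (lebesgue_tuple R N).

Lemma measurable_marginal_transform : measurable_fun setT F.
Proof.
apply/measurable_fun_tnthP => i.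
rewrite (_ : _ \o _ = cdfR (X i) \o (@tnth N R)^~ i); last first.
  by apply/funext => x /=; rewrite tnth_mktuple.
by apply: measurableT_comp; [exact: measurable_cdfR|exact: measurable_tnth].
Qed.

Lemma marginal_transform_cube x : unit_cube (F x).
Proof. by move=> i; rewrite tnth_mktuple cdfR_ge0 cdfR_le1. Qed.

Lemma measurable_unit_cube : measurable (@unit_cube R N).
Proof.
apply: (@measurable_box _ _ (fun=> [set y | (0 <= y <= 1)%R])) => i.
rewrite (_ : mkset _ = `[0%R, 1%R]%classic); first exact: measurable_itv.
by apply/seteqP; split => y /=; rewrite in_itv.
Qed.

Hypothesis hpm : forall i,
  is_density (T := R) (@lebesgue_measure R) (distribution P (X i)) (pm i).

Lemma measurable_marginal_product : measurable_fun setT w.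
Proof.
apply: measurable_prod => i _; have [mpm _ _] := hpm i.
by apply: measurableT_comp mpm _; exact: measurable_tnth.
Qed.

Lemma marginal_product_ge0 x : (0 <= w x)%R.
Proof. by apply: prodr_ge0 => i _; have [_ + _] := hpm i. Qed.

(** This is the product of the marginal laws, as [marginal_measure_box] shows: the law that
    independent coordinates would have. *)
Definition marginal_measure : {measure set (N.-tuple R) -> \bar R} :=
  density_measure L measurable_marginal_product marginal_product_ge0.
Local Notation nu := marginal_measure.

Lemma marginal_measure_box (A : 'I_N -> set R) :
  (forall i, measurable (A i)) ->
  nu (box A) = \prod_(i < N) distribution P (X i) (A i).
Proof.
move=> mA; rewrite [LHS]integral_prod_box//.
- by apply: eq_bigr => i _; have [_ _ ->] := hpm i.
- by move=> i; have [] := hpm i.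
- by move=> i x; have [_ + _] := hpm i.
Qed.

Lemma marginal_measure_setT : nu setT = 1.
Proof.
rewrite (_ : setT = box (fun=> setT)); last by apply/esym; rewrite -subTset.
by rewrite marginal_measure_box// big1// => i _; rewrite probability_setT.
Qed.

Lemma marginal_measure_fin : fin_num_fun nu.
Proof.
apply: lty_fin_num_fun; rewrite marginal_measure_setT; exact: ltry.
Qed.

Lemma integral_marginal_measure E (h : N.-tuple R -> \bar R) :
  measurable E -> measurable_fun E h -> (forall x, 0 <= h x) ->
  \int[nu]_(x in E) h x = \int[L]_(x in E) (h x * (w x)%:E).
Proof.
move=> mE mh h0.
pose nu' : {finite_measure set (N.-tuple R) -> \bar R} :=
  HB.pack (Measure.sort nu)
    (Measure_isFinite.Build _ _ _ (Measure.sort nu) marginal_measure_fin).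
apply: (@integral_density _ _ _ L nu' w) => //; split => //.
- exact: measurable_marginal_product.
- exact: marginal_product_ge0.
Qed.


Lemma distribution_set1 i r : distribution P (X i) [set r] = 0.
Proof.
have [mpm _ ->//] := hpm i.
apply: (@null_set_integral _ _ _ (@lebesgue_real R)) => //.
- by apply/measurable_EFinP; exact: measurable_funTS.
- exact: lebesgue_measure_set1.
Qed.

(** By uniqueness it suffices to compare the pushforward with Lebesgue measure restricted to the
    cube on orthants. There both factor over the coordinates, and the one-dimensional transform
    matches the factors. *)
Lemma pushforward_marginal_measure A : measurable A -> A `<=` @unit_cube R N ->
  nu (F @^-1` A) = L A.
Proof.
move=> mA A01; rewrite -[in RHS](setIidl A01).
pose m1 : {measure set (N.-tuple R) -> \bar R} :=
  measure_function_pushforward__canonical__measure_function_Measure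
    nu measurable_marginal_transform.
apply: (@tuple_measure_unique _ _ m1 (mrestr L measurable_unit_cube)) => //.
- move=> u.
  have -> : m1 (lower_orthant u) =
      nu (box (fun i => [set y | (cdfR (X i) y <= tnth u i)%R])).
    congr (nu _); apply/seteqP.
    by split => x h i; have := h i; rewrite /= tnth_mktuple.
  have mcdf i : measurable [set y | (cdfR (X i) y <= tnth u i)%R].
    rewrite (_ : mkset _ = cdfR (X i) @^-1` `]-oo, tnth u i]).
      by rewrite -[X in measurable X]setTI; exact: measurable_cdfR.
    by apply/seteqP; split => y /=; rewrite in_itv.
  rewrite marginal_measure_box//.
  rewrite -[RHS]/(L (lower_orthant u `&` unit_cube)).
  rewrite (_ : _ `&` _ = box
      (fun i => [set y | (0 <= y <= 1)%R] `&` `]-oo, tnth u i])); last first.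
    apply/seteqP; split => x.
      by move=> [h1 h2] i; split; [exact: h2|rewrite /= in_itv; exact: h1].
    move=> h; split => i; last by have [] := h i.
    by have [_] := h i; rewrite /= in_itv.
  rewrite [RHS]lebesgue_tuple_box.
    by apply: eq_bigr => i _; exact/probability_integral_transform/distribution_set1.
  move=> i; apply: measurableI => //.
  rewrite (_ : mkset _ = `[0%R, 1%R]%classic); first exact: measurable_itv.
  by apply/seteqP; split => y /=; rewrite in_itv.
- move=> u; rewrite /m1/= /pushforward (le_lt_trans _ (ltry 1%R))//.
  rewrite -marginal_measure_setT le_measure ?inE//.
  rewrite -[X in measurable X]setTI; apply: measurable_marginal_transform => //.
  exact: measurable_lower_orthant.
Qed.

Lemma integral_marginal_transform D (h : N.-tuple R -> \bar R) :
  measurable D -> D `<=` @unit_cube R N -> measurable_fun D h ->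
  {in D, forall u, 0 <= h u} ->
  \int[L]_(u in D) h u = \int[nu]_(x in F @^-1` D) h (F x).
Proof.
move=> mD D01 mh h0.
rewrite -(ge0_integral_pushforward measurable_marginal_transform nu)//.
apply: (eq_measure_integral
  (measure_function_pushforward__canonical__measure_function_Measure
    nu measurable_marginal_transform)) => A mA AD.
by apply/esym/pushforward_marginal_measure => //; exact: subset_trans D01.
Qed.

End marginals.

(** * The joint density expressed through the copula density *)

Section copula_density.
Context {d : measure_display} {T : measurableType d} {R : realType}
  {P : probability T R} {N : nat}.
Variables (X : 'I_N -> {RV P >-> R}) (pm : 'I_N -> R -> R).
Variables (C : N.-tuple R -> \bar R) (c : N.-tuple R -> R).
Hypothesis hpm : forall i,
  is_density (T := R) (@lebesgue_measure R) (distribution P (X i)) (pm i).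
Hypothesis hC : copula_of X C.
Hypothesis hc : is_copula_density C c.

Local Notation w := (marginal_product pm).
Local Notation F := (marginal_transform X).
Local Notation L := (lebesgue_tuple R N).
Local Notation nu := (marginal_measure hpm).

Lemma measurable_comp_marginal_transform d' (T' : measurableType d')
    (h : N.-tuple R -> T') :
  measurable_fun unit_cube h -> measurable_fun setT (h \o F).
Proof.
move=> mh; apply: (measurable_comp measurable_unit_cube) mh _.
  by move=> _ [x _ <-]; exact: marginal_transform_cube.
exact: measurable_marginal_transform.
Qed.

Lemma measurable_joint_density :
  measurable_fun setT (fun x => c (F x) * w x)%R.
Proof.
have [mc _ _] := hc; apply: measurable_funM.
  exact: measurable_comp_marginal_transform.
exact: measurable_marginal_product hpm.
Qed.

Lemma joint_density_ge0 x : (0 <= c (F x) * w x)%R.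
Proof.
have [_ c0 _] := hc.
by rewrite mulr_ge0 ?(marginal_product_ge0 hpm)// c0//; exact: marginal_transform_cube.
Qed.

Lemma distribution_function_joint_density x :
  distribution_function (distribution P (random_vector X)) x =
  \int[L]_(y in lower_orthant x) (c (F y) * w y)%:E.
Proof.
have [mc c0 cE] := hc; have [_ ->] := hC.
rewrite cE; last exact: (marginal_transform_cube X).
set B := mkset _.
have BE : B = box (fun i => `[0%R, cdfR (X i) (tnth x i)]%classic).
  by apply/seteqP; split => v h i; have := h i; rewrite /= in_itv/= tnth_mktuple.
have mB : measurable B by rewrite BE; apply: measurable_box => i.
have B01 : B `<=` @unit_cube R N.
  move=> v Bv i; have := Bv i; rewrite tnth_mktuple => /andP[-> /le_trans]; apply.
  exact: cdfR_le1.
have mO := measurable_lower_orthant x.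
have mcF : measurable_fun setT (EFin \o (c \o F)).
  by apply/measurable_EFinP; exact: measurable_comp_marginal_transform.
have cF0 y : 0 <= (c (F y))%:E.
  by rewrite lee_fin; apply: c0; exact: marginal_transform_cube.
have mFB : measurable (F @^-1` B).
  by rewrite -[X in measurable X]setTI; exact: measurable_marginal_transform.
rewrite (integral_marginal_transform hpm)//; last 2 first.
- apply/measurable_EFinP; apply: measurable_funS B01 mc; exact: measurable_unit_cube.
- by move=> v; rewrite inE lee_fin => /B01; exact: c0.
(* The inclusion can be strict: where some marginal distribution function is flat, points beyond [x]
   still map into [B]. *)
have OB : lower_orthant x `<=` F @^-1` B.
  by move=> y yx i; rewrite !tnth_mktuple cdfR_ge0/= cdfR_homo.
(* The two sets have the same measure, because F_i pushes the i-th margin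
   forward to the uniform law. *)
have nuE : nu (F @^-1` B) = nu (lower_orthant x).
  rewrite pushforward_marginal_measure// BE lower_orthantE marginal_measure_box//.
  rewrite [LHS]lebesgue_tuple_box//; apply: eq_bigr => i _.
  rewrite -[RHS]/(cdf (X i) (tnth x i)) cdfRE lebesgue_measure_itv/= lte_fin.
  case: ltP => [_|h]; rewrite ?sube0//; congr EFin; apply/le_anti.
  by rewrite cdfR_ge0.
have nufin A : measurable A -> nu A \is a fin_num.
  exact: marginal_measure_fin.
rewrite (@ge0_negligible_integral _ _ _ nu _ (F @^-1` B `\` lower_orthant x))//.
- rewrite setDD setIidr// (integral_marginal_measure hpm)//.
  exact: measurable_funTS.
- exact: measurableD.
- exact: measurable_funTS.
- rewrite measureD// ?setIidr//; last by rewrite ltey_eq nufin.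
  by rewrite [X in X - _]nuE subee// nufin.
Qed.

Lemma distribution_joint_density A : measurable A ->
  distribution P (random_vector X) A = \int[L]_(x in A) (c (F x) * w x)%:E.
Proof.
apply: (@tuple_measure_unique _ _ (distribution P (random_vector X))
  (density_measure L measurable_joint_density joint_density_ge0)).
- exact: distribution_function_joint_density.
- move=> x; apply: le_lt_trans (ltry 1%R); apply: probability_le1.
  exact: measurable_lower_orthant.
Qed.

(** Functions with equal integrals over all measurable sets agree almost everywhere; [p] is
    integrable because its total integral is 1. *)
Lemma joint_density_ae_eq p :
  is_density L (distribution P (random_vector X)) p ->
  ae_eq L setT (EFin \o p) (fun x => (c (F x) * w x)%:E).
Proof.
move=> [mp p0 pE]; apply: integral_ae_eq => //.
- apply/integrableP; split; first exact/measurable_EFinP.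
  rewrite (eq_integral (EFin \o p)).
    by rewrite -[ltLHS]pE// probability_setT ltry.
  by move=> x _ /=; rewrite ger0_norm.
- by apply/measurable_EFinP; exact: measurable_joint_density.
- by move=> A _ mA; rewrite -distribution_joint_density// pE.
Qed.

End copula_density.

(** * The logarithmic integrands and the final change of variables *)

Lemma mule_lneE (R : realType) (r : R) :
  (0 <= r)%R -> r%:E * lne r%:E = (r * ln r)%:E.
Proof.
rewrite le_eqVlt => /predU1P[<-|r0]; first by rewrite mul0e mul0r.
by rewrite lne_EFin// EFinM.
Qed.

(** Separating the zeros of [p] and [w] reduces the extended-real convention to a real formula, from
    which measurability can be read off. *)
Lemma mule_lne_divE (R : realType) (p w : R) : (0 <= p)%R -> (0 <= w)%R ->
  p%:E * lne (p%:E / w%:E) =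
  if p == 0%R then 0 else if w == 0%R then +oo else (p * (ln p - ln w))%:E.
Proof.
move=> p0 w0; case: eqP => [->|/eqP pn0]; first by rewrite mul0e.
have {p0 pn0} p0 : (0 < p)%R by rewrite lt_def pn0.
rewrite inver; case: eqP => [_|/eqP wn0].
  by rewrite gt0_muley ?lte_fin//= gt0_muley ?lte_fin.
have {w0 wn0} w0 : (0 < w)%R by rewrite lt_def wn0.
by rewrite -EFinM lne_EFin ?divr_gt0// ln_div ?posrE// EFinM.
Qed.

Lemma measurable_mule_lne_div d (T : measurableType d) (R : realType)
    (p w : T -> R) : measurable_fun setT p -> measurable_fun setT w ->
  (forall x, (0 <= p x)%R) -> (forall x, (0 <= w x)%R) ->
  measurable_fun setT (fun x => (p x)%:E * lne ((p x)%:E / (w x)%:E)).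
Proof.
move=> mp mw p0 w0.
rewrite (_ : (fun _ => _) = fun x => if p x == 0%R then 0 else
    if w x == 0%R then +oo else (p x * (ln (p x) - ln (w x)))%:E); last first.
  by apply/funext => x; exact: mule_lne_divE.
apply: measurable_fun_ifT => //; first exact: measurable_fun_eqr.
apply: measurable_fun_ifT => //; first exact: measurable_fun_eqr.
apply/measurable_EFinP; apply: measurable_funM => //.
by apply: measurable_funB; apply: measurableT_comp => //; exact: measurable_ln.
Qed.

Theorem theorem1 (R : realType) (d : measure_display) (T : measurableType d)
    (P : probability T R) (N : nat) (X : 'I_N -> {RV P >-> R})
    (p : N.-tuple R -> R) (pm : 'I_N -> R -> R)
    (C : N.-tuple R -> \bar R) (c : N.-tuple R -> R)
    (hp : is_density (lebesgue_tuple R N) (distribution P (random_vector X)) p)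
    (hpm : forall i : 'I_N,
      is_density (T := R) (@lebesgue_measure R) (distribution P (X i)) (pm i))
    (hC : copula_of X C)
    (hc : is_copula_density C c) :
  mutual_information p pm = - copula_entropy c.
Proof.
rewrite /mutual_information /copula_entropy oppeK.
set L := lebesgue_tuple R N.
pose w := marginal_product pm; pose F := marginal_transform X.
have [mc c0 _] := hc; have [mp p0 _] := hp.
have mw : measurable_fun setT w := measurable_marginal_product hpm.
have w0 : forall x, (0 <= w x)%R := marginal_product_ge0 hpm.
have cF0 x : (0 <= c (F x))%R by apply: c0; exact: marginal_transform_cube.
pose h u := (c u * ln (c u))%:E.
have mh : measurable_fun unit_cube h.
  apply/measurable_EFinP; apply: measurable_funM => //.
  exact: measurableT_comp (@measurable_ln R) mc.
have mhF : measurable_fun setT (h \o F).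
  exact: measurable_comp_marginal_transform.
have change (k : N.-tuple R -> \bar R) : measurable_fun unit_cube k ->
    (forall u, 0 <= k u) ->
    \int[L]_(u in unit_cube) k u = \int[L]_x (k (F x) * (w x)%:E).
  move=> mk k0; rewrite (integral_marginal_transform hpm)//; last first.
    exact: measurable_unit_cube.
  have -> : F @^-1` @unit_cube R N = setT.
    by rewrite -subTset => x _; exact: marginal_transform_cube.
  rewrite integral_marginal_measure//.
  exact: measurable_comp_marginal_transform.
have hw_pos x : (fun x => h (F x) * (w x)%:E)^\+ x = h^\+ (F x) * (w x)%:E.
  by rewrite !funeposE maxe_pMl ?lee_fin// mul0e.
have hw_neg x : (fun x => h (F x) * (w x)%:E)^\- x = h^\- (F x) * (w x)%:E.
  by rewrite !funenegE maxe_pMl ?lee_fin// mul0e mulNe.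
transitivity (\int[L]_x (h (F x) * (w x)%:E)); last first.
  transitivity (\int[L]_(u in unit_cube) h u); last first.
    by apply: eq_integral => u; rewrite inE => u01; rewrite mule_lneE// c0.
  rewrite integralE [RHS]integralE.
  congr (_ - _); rewrite change//; try by apply: eq_integral.
    exact: measurable_funepos.
  exact: measurable_funeneg.
apply: ae_eq_integral => //.
- exact: measurable_mule_lne_div.
- by apply: emeasurable_funM => //; exact/measurable_EFinP.
- apply: filterS (joint_density_ae_eq hpm hC hc hp) => x /= /(_ I) [pE] _.
  rewrite -[X in _ / X%:E]/(w x) mule_lne_divE// pE -/F -/w /h -EFinM.
  (* Where [w] vanishes so does [p], by the almost everywhere identity, so the value +oo does not
     occur and both sides are 0. *)
  have [->|wn0] := eqVneq (w x) 0%R; first by rewrite !mulr0 eqxx.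
  rewrite mulf_eq0 (negbTE wn0) orbF.
  case: eqVneq => [->|cn0]; first by rewrite !mul0r.
  (* In the remaining case all factors are positive, and subtracting ln w from ln (c(F) w) leaves ln
     c(F). *)
  have cF_gt0 : (0 < c (F x))%R by rewrite lt_def cn0/=.
  by rewrite lnM ?posrE// ?lt_def ?wn0 ?w0// addrK mulrAC.
Qed.
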